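(* Let $k\geq 2$ be an integer. The sphere $S^{2k-1}$ cannot be covered by at most $2k+1$ open sets, none of which contains a pair of antipodal points, such that every point of $S^{2k-1}$ is contained in at most $k+1$ of these sets. The sphere $S^{2k}$ cannot be covered by at most $2k+2$ open sets, none of which contains a pair of antipodal points, such that every point of $S^{2k}$ is contained in at most $k+2$ of these sets. *)

(* Defs.v *)
From mathcomp Require Import all_boot all_order all_algebra.
From mathcomp Require Import all_classical all_reals all_analysis.

Set Implicit Arguments.
Unset Strict Implicit.
Unset Printing Implicit Defensive.

Import Order.TTheory GRing.Theory Num.Theory.
Import numFieldNormedType.Exports.

Local Open Scope classical_set_scope.
Local Open Scope ring_scope.

(* S^n in R^(n+1). The library's norm on row vectors is the sup norm, so the
   Euclidean norm is written out; the topology on row vectors is the usual one. *)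
Definition sphere (R : realType) (n : nat) : set 'rV[R]_n.+1 :=
  [set x | \sum_(i < n.+1) x ord0 i ^+ 2 = 1].
Arguments sphere R n _ : clear implicits.

(* [subspace S] makes the points outside S isolated, so its openness only
   constrains [A `&` S]; the inclusion has to be required separately. *)
Definition open_in_sphere (R : realType) (n : nat) (A : set 'rV[R]_n.+1) :
    Prop :=
  A `<=` sphere R n /\ open (A : set (subspace (sphere R n))).

Definition antipodal_free (R : realType) (n : nat) (A : set 'rV[R]_n.+1) :
    Prop :=
  ~ exists x : 'rV[R]_n.+1, A x /\ A (- x).

Definition multiplicity (R : realType) (n m : nat)
    (A : 'I_m -> set 'rV[R]_n.+1) (x : 'rV[R]_n.+1) : nat :=
  #|[pred i : 'I_m | x \in A i]|.

Definition antipodal_free_open_cover (R : realType) (n m : nat)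
    (A : 'I_m -> set 'rV[R]_n.+1) : Prop :=
  [/\ forall i, open_in_sphere (A i),
      forall i, antipodal_free (A i)
    & sphere R n `<=` \bigcup_i A i].

(* Main.v *)
Require Import Defs.
From mathcomp Require Import all_boot all_order all_fingroup all_algebra.
From mathcomp Require Import zify lra.
From mathcomp Require Import all_classical all_reals all_analysis.

(* Let [d_i] be the distance to the complement of the [i]-th set, for [n + 2]
   antipodal-free sets (padded with empty ones) covering [S^n], and
   [g_i x = d_i x - d_i (- x)].  Borsuk-Ulam applied to the [n] odd functions
   [g_i - g_0], [0 < i <= n], gives [x] with [g_0 x = ... = g_n x = c].
   If [c = 0] then neither [x] nor [- x] is
   in one of the first [n + 1] sets, so both are in the last one, which is
   absurd.  If [c > 0] (resp. [c < 0]) then [x] (resp. [- x]) is in the first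
   [n + 1] sets, which exceeds the allowed multiplicity since [k >= 2].

   Borsuk-Ulam is derived from the octahedral Tucker lemma, itself proved by
   Fan's parity count: modulo 2, the number of maximal chains of sign vectors
   on [d] coordinates whose labels alternate in sign when sorted by absolute
   value does not depend on [d].  To discretize an odd map on the boundary of
   the cube [-1, 1]^(n+1), sign vectors of length [(n + 1) L] with few
   alternations are labelled by their alternation number, which uses all labels
   but [n].  A vector with at least [(n + 1) L - n] alternations has at most [n]
   zeros and alternates perfectly on one of its [n + 1] blocks of length [L];
   the alternating block means then give a point of the boundary of the cube,
   which moves by at most [n / L] along the order, and the remaining [n] labels
   are read off the map at that point. *)

Set Implicit Arguments.
Unset Strict Implicit.
Unset Printing Implicit Defensive.

Import Order.TTheory GRing.Theory Num.Theory.
Import numFieldNormedType.Exports.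

Local Open Scope classical_set_scope.
Local Open Scope ring_scope.

(** * Alternating label sets modulo 2 *)

(** Comparing [enum_rank] selects one point of each orbit; the two halves of the sum agree and
    cancel. *)
Lemma big_addb_involution (T : finType) (P F : pred T) (f : T -> T) :
  involutive f -> (forall x, P x -> f x != x) ->
  (forall x, P (f x) = P x) -> (forall x, P x -> F (f x) = F x) ->
  \big[addb/false]_(x | P x) F x = false.
Proof.
move=> fK fx fP fF; pose lt x := (enum_rank x < enum_rank (f x))%N.
rewrite (bigID lt) /= [X in _ (+) X](reindex_inj (inv_inj fK)) /=.
have cancel (a b : bool) : b = a -> a (+) b = false by move=> ->; rewrite addbb.
apply: cancel.
apply: eq_big => x; last by case/andP=> Px _; rewrite fF // -fP.
rewrite fP; case Px: (P x) => //=; rewrite /lt fK -leqNgt ltn_neqAle.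
by rewrite (inj_eq val_inj) (inj_eq enum_rank_inj) eq_sym fx.
Qed.

Fixpoint alternates (b : bool) (l : seq bool) : bool :=
  if l is x :: l' then (x == b) && alternates (~~ b) l' else true.

Definition delete T (i : nat) (l : seq T) := take i l ++ drop i.+1 l.

Lemma map_delete T U (f : T -> U) i l :
  map f (delete i l) = delete i (map f l).
Proof. by rewrite /delete map_cat map_take map_drop. Qed.

Lemma delete_subseq (T : eqType) i (l : seq T) : subseq (delete i l) l.
Proof.
rewrite /delete -{3}(cat_take_drop i l) cat_subseq //.
by rewrite -add1n -drop_drop drop_subseq.
Qed.

(** If a nonempty [l] alternates from [b] (resp. [~~ b]), only deleting its last (resp. first) entry
    leaves a list alternating from [b]. Otherwise such a deletion forces exactly one pair of equal
    neighbours, either of which can be deleted. *)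
Lemma alternates_delete b l :
  \big[addb/false]_(i < size l) alternates b (delete i l) =
  alternates b l (+) alternates (~~ b) l.
Proof.
elim: l b => [|x l IHl] b; first by rewrite big_ord0.
rewrite big_ord_recl /delete /= drop0.
under eq_bigr => i _ do rewrite -/(delete i l).
case: eqP => [->|/eqP xb] /=.
  rewrite IHl negbK; case: (b); case: (alternates _ _) => //=;
  by case: (alternates _ _).
rewrite big1 // addbF.
by rewrite eq_sym -addbN -negb_eqb in xb; case: x b xb => [] [].
Qed.

Lemma alternates_negb b l : alternates b (map negb l) = alternates (~~ b) l.
Proof. by elim: l b => //= x l IHl b; rewrite IHl; case: x b => [] []. Qed.

Lemma perm_delete (T : eqType) (x0 : T) i l : (i < size l)%N ->
  perm_eq (delete i l) (rem (nth x0 l i) l).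
Proof.
move=> il; rewrite -(perm_cons (nth x0 l i)).
have := perm_to_rem (mem_nth x0 il); apply: perm_trans.
rewrite -{3}(cat_take_drop i l) (drop_nth x0 il).
by rewrite perm_sym -[_ :: drop _ _]cat1s perm_catCA.
Qed.

(** For the codes [2 m + b] of signed labels, [leq] orders by the absolute value [m], and the parity
    is the sign. *)
Definition fan b (l : seq nat) := alternates b (map odd (sort leq l)).

Lemma fan_perm b l l' : perm_eq l l' -> fan b l = fan b l'.
Proof.
move=> pl; rewrite /fan; congr (alternates b (map odd _)).
by apply/perm_sortP => //; [exact: leq_total|exact: leq_trans|exact: anti_leq].
Qed.

(** Removal by value is insensitive to the order of [l], which can thus be sorted before the
    deletions are counted. *)
Lemma fan_delete_rem b l :
  \big[addb/false]_(i < size l) fan b (delete i l) =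
  \big[addb/false]_(x <- l) fan b (rem x l).
Proof.
rewrite (big_nth 0%N) big_mkord; apply: eq_bigr => i _.
exact/fan_perm/perm_delete.
Qed.

Lemma fan_coboundary b l :
  \big[addb/false]_(i < size l) fan b (delete i l) =
  fan b l (+) fan (~~ b) l.
Proof.
rewrite {2 3}/fan -alternates_delete fan_delete_rem.
have pl : perm_eq (sort leq l) l by rewrite perm_sort.
rewrite -(perm_big _ pl) /=.
under eq_bigr => x _.
  rewrite (@fan_perm _ _ (rem x (sort leq l))); last first.
    by apply/seq.permP => P; rewrite !count_rem (seq.permP pl) (perm_mem pl).
  over.
rewrite -fan_delete_rem size_map; apply: eq_bigr => i _.
rewrite -map_delete /fan sorted_sort //; first exact: leq_trans.
apply: (subseq_sorted leq_trans) (sort_sorted leq_total l).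
exact: delete_subseq.
Qed.

(* The label [2 m + b] stands for the [m]-th label with sign [b]. *)
Definition flip (l : nat) := (l./2.*2 + ~~ odd l)%N.

Lemma flip_double m (b : bool) : flip (m.*2 + b) = (m.*2 + ~~ b)%N.
Proof. by rewrite /flip; case: b => /=; lia. Qed.

Lemma odd_flip l : odd (flip l) = ~~ odd l.
Proof. by rewrite /flip oddD odd_double oddb. Qed.

Lemma leq_flip x y : (x <= y)%N -> y != flip x -> (flip x <= flip y)%N.
Proof. rewrite /flip; lia. Qed.

Lemma ltn_half x y : (x <= y)%N -> y != flip x -> odd x != odd y ->
  (x./2 < y./2)%N.
Proof. rewrite /flip; lia. Qed.

Definition complement_free (l : seq nat) := {in l &, forall x y, y != flip x}.

(** Without complementary labels, [flip] is monotone on [l] and so commutes with sorting. *)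
Lemma fan_flip b l : complement_free l -> fan b (map flip l) = fan (~~ b) l.
Proof.
move=> cl; rewrite /fan -alternates_negb -map_comp.
have -> : sort leq (map flip l) = map flip (sort leq l).
  apply: (sorted_eq leq_trans anti_leq); first exact: sort_sorted leq_total _.
  - apply: (homo_sorted_in (P := mem l) (e := leq)); last first.
    + exact: sort_sorted leq_total _.
    + by apply/allP => x; rewrite mem_sort.
    by move=> x y xl yl /leq_flip; apply; apply: cl.
  - by rewrite perm_sort perm_sym; apply/perm_map; rewrite perm_sort.
rewrite -map_comp; congr alternates; apply: eq_map => x /=.
exact: odd_flip.
Qed.

(** Sorted neighbours of opposite signs that are not complementary differ in absolute value, so the
    halves increase strictly below [m]. *)
Lemma fan_size b l m : complement_free l -> {in l, forall x, (x < m.*2)%N} ->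
  fan b l -> (size l <= m)%N.
Proof.
move=> cl lm; rewrite /fan.
have cs : complement_free (sort leq l).
  by move=> x y; rewrite !mem_sort; exact: cl.
have : {in sort leq l, forall x, (x < m.*2)%N}.
  by move=> x; rewrite mem_sort; exact: lm.
have := sort_sorted leq_total l.
rewrite -(size_sort leq); move: (sort leq l) cs => {cl lm} s cs ss sm al.
have : sorted ltn (map half s).
  case: s cs ss {sm} al => //= x s; elim: s x b => //= y s IHs x b cs.
  case/andP=> xy ys /and3P[/eqP xb /eqP yb al].
  apply/andP; split.
    by apply: ltn_half; rewrite ?cs ?inE ?eqxx ?orbT// xb yb; case: (b).
  apply: (IHs y (~~ b)) => //; last by rewrite yb eqxx.
  by move=> u v us vs; apply: cs; rewrite inE ?us ?vs orbT.
move=> /(sorted_uniq ltn_trans ltnn) us.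
rewrite -(size_map half) -(size_iota 0 m) uniq_leq_size // => _ /mapP[x xs ->].
by rewrite mem_iota add0n leq0n -ltn_double (leq_ltn_trans _ (sm x xs)) //; lia.
Qed.

(** * The octahedral Tucker lemma *)

Lemma flipK : involutive flip.
Proof. by move=> l; rewrite /flip; lia. Qed.

Section OctahedralTucker.
Variables (N : nat) (label : (nat -> int) -> nat).
Implicit Types (s : {ffun 'I_N -> bool}) (p : 'S_N).

Definition sign_vector (X : nat -> int) :=
  (forall c, X c \in [:: -1; 0; 1]) /\ (exists2 c, (c < N)%N & X c != 0).

(** Chains of sign vectors for this order are the simplices of the barycentric subdivision of the
    boundary of the cross-polytope. *)
Definition sign_le (X Y : nat -> int) := forall c, X c = 0 \/ X c = Y c.

(* The pair [(s, p)] encodes the maximal chain of sign vectors in which the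
   coordinate [c] gets the sign [s c] at time [p c]. *)
Definition chain_vector s p (j : nat) (c : nat) : int :=
  if (insub c : option 'I_N) is Some i then
    if (p i < j)%N then (if s i then 1 else -1) else 0
  else 0.

Definition chain_labels s p d :=
  [seq label (chain_vector s p j) | j <- iota 1 d].

Lemma chain_vector_ext s s' p p' j :
  (forall c, (p c < j)%N = (p' c < j)%N) ->
  (forall c, (p c < j)%N -> s c = s' c) ->
  chain_vector s p j = chain_vector s' p' j.
Proof.
move=> pp ss; apply/funext => c; rewrite /chain_vector.
case: insubP => // i _ _; rewrite -pp; case: ifP => // /ss -> //.
Qed.

Lemma chain_vector_opp s s' p j :
  (forall c, (p c < j)%N -> s' c = ~~ s c) ->
  chain_vector s' p j = (fun c => - chain_vector s p j c).
Proof.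
move=> ss; apply/funext => c; rewrite /chain_vector.
case: insubP => [i _ _|_]; last by rewrite oppr0.
by case: ifP => [/ss ->|_]; rewrite ?oppr0 //; case: (s i); rewrite ?opprK.
Qed.

Lemma chain_sign_vector s p j : (0 < j <= N)%N ->
  sign_vector (chain_vector s p j).
Proof.
case/andP=> j0 jN; split=> [c|].
  rewrite /chain_vector; case: insubP => // i _ _.
  by case: ifP => // _; case: ifP.
have N0 : (0 < N)%N := leq_trans j0 jN.
exists (val ((p^-1)%g (Ordinal N0))); first exact: ltn_ord.
by rewrite /chain_vector valK permKV /= j0; case: ifP.
Qed.

Lemma chain_vector_le s p i j : (i <= j)%N ->
  sign_le (chain_vector s p i) (chain_vector s p j).
Proof.
move=> ij c; rewrite /chain_vector; case: insubP => [k _ _|]; last by left.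
by case: ifP => [/leq_trans -> //|_]; [right|left].
Qed.

Hypothesis label_opp : forall X, sign_vector X ->
  label (fun c => - X c) = flip (label X).
Hypothesis label_le : forall X Y, sign_vector X -> sign_vector Y ->
  sign_le X Y -> label Y != flip (label X).

Lemma chain_labels_complement_free s p d : (d <= N)%N ->
  complement_free (chain_labels s p d).
Proof.
move=> dN _ _ /mapP[i + ->] /mapP[j + ->]; rewrite !mem_iota !add1n !ltnS.
move=> /andP[i0 id] /andP[j0 jd].
have [ij|/ltnW ji] := leqP i j.
  apply: label_le (chain_vector_le _ _ ij); apply: chain_sign_vector.
    by rewrite i0 (leq_trans id).
  by rewrite j0 (leq_trans jd).
rewrite -(inj_eq (inv_inj flipK)) flipK eq_sym.
apply: label_le (chain_vector_le _ _ ji); apply: chain_sign_vector.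
  by rewrite j0 (leq_trans jd).
by rewrite i0 (leq_trans id).
Qed.

Definition signs_upto d s := [forall c : 'I_N, (d <= c)%N ==> s c].
Definition perm_upto d p := [forall c : 'I_N, (d <= c)%N ==> (p c == c)].

(* The sum runs over the maximal chains on the first [d] coordinates: freezing
   the other entries of [(s, p)] avoids changing the index types with [d]. *)
Definition fan_parity d :=
  \big[addb/false]_(s | signs_upto d s) \big[addb/false]_(p | perm_upto d p)
    fan true (chain_labels s p d).

Lemma perm_upto_leq d p (c : 'I_N) j :
  perm_upto d p -> (p c < j)%N -> (j <= d)%N -> (c < d)%N.
Proof.
move=> /forallP/(_ c)/implyP pd pcj jd; rewrite ltnNge; apply/negP => dc.
have := pd dc; move: pcj => /[swap] /eqP ->; lia.
Qed.

Lemma eq_in_chain_labels s s' p p' l :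
  {in l, forall j, chain_vector s p j = chain_vector s' p' j} ->
  [seq label (chain_vector s p j) | j <- l] =
  [seq label (chain_vector s' p' j) | j <- l].
Proof. by move=> e; apply/eq_in_map => j /e ->. Qed.

(* Exchanging the coordinates added at the times [i] and [i + 1] only changes
   the vector that is deleted. *)
Lemma fan_parity_inner s d (i : nat) : (d < N)%N -> (i < d)%N ->
  \big[addb/false]_(p | perm_upto d.+1 p)
    fan true (delete i (chain_labels s p d.+1)) = false.
Proof.
move=> dN id.
have iN : (i < N)%N by lia.
have iN' : (i.+1 < N)%N by lia.
pose t := tperm (Ordinal iN) (Ordinal iN').
have tt : (t * t = 1)%g by rewrite tperm2.
apply: (big_addb_involution (f := fun p => (p * t)%g)).
- by move=> p; rewrite -mulgA tt mulg1.
- move=> p _; rewrite -{2}(mulg1 p) (inj_eq (mulgI p)).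
  apply/eqP => /permP/(_ (Ordinal iN)); rewrite tpermL perm1.
  by move/(congr1 val) => /=; lia.
- move=> p; apply: eq_forallb => c; case: (leqP d.+1 c) => //= dc.
  rewrite permM; apply/eqP/eqP => [|->].
    move/(congr1 t); rewrite tpermK => ->.
    by rewrite tpermD // -val_eqE /=; lia.
  by rewrite tpermD // -val_eqE /=; lia.
move=> p _; congr (fan _ _); rewrite -!map_delete; apply: eq_in_chain_labels.
move=> j jl; apply: chain_vector_ext => // c; rewrite permM.
have ji : j != i.+1.
  move: jl; rewrite /delete mem_cat take_iota drop_iota !mem_iota; lia.
case: tpermP => [->|->|//] /=; lia.
Qed.

(* When the coordinate added last is not [d], both signs of that coordinate
   occur, with the same vectors before the last step. *)
Lemma fan_parity_outer d (dN : (d < N)%N) :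
  \big[addb/false]_(s | signs_upto d s) \big[addb/false]_(p | perm_upto d.+1 p)
    fan true (chain_labels s p d) = fan_parity d.
Proof.
pose o := Ordinal dN; rewrite /fan_parity.
under eq_bigr => s _ do rewrite (bigID (fun p => p o == o)) /=.
rewrite big_split /= [X in _ (+) X]exchange_big /= [X in _ (+) X]big1.
  rewrite addbF; apply: eq_bigr => s _; apply: eq_bigl => p.
  apply/andP/forallP => [[/forallP pd po] c|pd].
    apply/implyP; rewrite leq_eqVlt => /orP[dc|dc].
      by have -> : c = o by apply/val_inj/esym/eqP.
    by have /implyP := pd c; apply.
  split; last by have /implyP := pd o; apply.
  apply/forallP => c; apply/implyP => /ltnW dc.
  by have /implyP := pd c; apply.
move=> p /andP[pd po]; pose c := (p^-1)%g o.
have pc : p c = o by rewrite permKV.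
have cd : (c < d)%N.
  rewrite ltn_neqAle; apply/andP; split.
    by apply: contraNneq po => cd; rewrite -[X in _ == X]pc (_ : o = c) //;
      apply/val_inj.
  by rewrite -ltnS; apply: (perm_upto_leq pd) (leqnn _); rewrite pc /=.
pose f s : {ffun 'I_N -> bool} := [ffun i => (i == c) (+) s i].
apply: (big_addb_involution (f := f)).
- by move=> s; apply/ffunP => i; rewrite !ffunE addKb.
- by move=> s _; apply/eqP => /ffunP/(_ c); rewrite ffunE eqxx; case: (s c).
- move=> s; apply: eq_forallb => i; case: (leqP d i) => //= di.
  by rewrite ffunE (_ : i == c = false) // -val_eqE /=; lia.
move=> s _; congr (fan _ _); apply: eq_in_chain_labels => j.
rewrite mem_iota => /andP[_ jd]; apply: chain_vector_ext => // i pij.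
rewrite ffunE; case: eqP => // ic; move: pij; rewrite ic pc /=; lia.
Qed.

(** Negating the first [d + 1] coordinates matches the chains with a negative coordinate [d] to
    those with a positive one, and turns [fan true] into [fan false]. By [fan_coboundary] the total
    is a sum over deletions: the inner ones cancel, and deleting the last vector leaves the count
    for [d]. *)
Lemma fan_parityS d : (d < N)%N -> fan_parity d.+1 = fan_parity d.
Proof.
move=> dN; pose o := Ordinal dN; rewrite -(fan_parity_outer dN) {1}/fan_parity.
rewrite (bigID (fun s : {ffun 'I_N -> bool} => s o)) /=.
pose f s : {ffun 'I_N -> bool} := [ffun i : 'I_N => (i <= d)%N (+) s i].
have fK : involutive f by move=> s; apply/ffunP => i; rewrite !ffunE addKb.
have upto s : signs_upto d s = signs_upto d.+1 s && s o.
  apply/forallP/andP => [sd|[/forallP sd so] c]; last first.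
    apply/implyP; rewrite leq_eqVlt => /orP[dc|dc].
      by have -> : c = o by apply/val_inj/esym/eqP.
    by have /implyP := sd c; apply.
  split; last by have /implyP := sd o; apply.
  apply/forallP => c; apply/implyP => /ltnW dc.
  by have /implyP := sd c; apply.
rewrite [X in _ (+) X](reindex_inj (inv_inj fK)) /=.
under [X in _ (+) X]eq_bigl => s.
  have -> : signs_upto d.+1 (f s) && ~~ f s o = signs_upto d s.
    rewrite upto; congr (_ && _); last by rewrite ffunE leqnn /= negbK.
    apply: eq_forallb => c; case: (leqP d.+1 c) => //= dc.
    by rewrite ffunE leqNgt dc.
  over.
under eq_bigl => s do rewrite -upto.
rewrite -big_split /=; apply: eq_bigr => s _.
rewrite -big_split /=.
transitivity (\big[addb/false]_(p | perm_upto d.+1 p)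
    \big[addb/false]_(i < d.+1) fan true (delete i (chain_labels s p d.+1))).
  apply: eq_bigr => p pd.
  have size_l : size (chain_labels s p d.+1) = d.+1.
    by rewrite size_map size_iota.
  have := fan_coboundary true (chain_labels s p d.+1); rewrite size_l => ->.
  congr (_ (+) _); rewrite -fan_flip; last exact: chain_labels_complement_free.
  congr (fan _ _); rewrite -map_comp; apply/eq_in_map => j.
  rewrite mem_iota => /andP[j0 jd] /=; have jN : (0 < j <= N)%N by lia.
  rewrite -label_opp; last exact: chain_sign_vector.
  congr label; apply: chain_vector_opp => c pcj.
  rewrite ffunE -ltnS (perm_upto_leq pd pcj) //; lia.
rewrite exchange_big big_ord_recr /= big1 /= => [|i _]; last first.
  exact: fan_parity_inner.
apply: eq_bigr => p _; congr (fan _ _).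
rewrite /delete drop_oversize ?cats0 ?size_map ?size_iota //.
by rewrite /chain_labels -map_take take_iota (minn_idPl (leqnSn d)).
Qed.

Lemma fan_parity0 : fan_parity 0.
Proof.
rewrite /fan_parity (big_pred1 [ffun=> true]) => [|s]; last first.
  apply/forallP/eqP => [sd|-> c]; last by rewrite ffunE implybT.
  by apply/ffunP => c; rewrite ffunE; exact: sd.
rewrite (big_pred1 1%g) // => p.
apply/forallP/eqP => [pd|-> c]; last by rewrite perm1 eqxx implybT.
by apply/permP => c; rewrite perm1; apply/eqP; exact: pd.
Qed.

Lemma fan_parity_true d : (d <= N)%N -> fan_parity d.
Proof.
by elim: d => [|d IHd] dN; rewrite ?fan_parity0 // fan_parityS // IHd // ltnW.
Qed.

End OctahedralTucker.

(** Without a complementary pair, the odd count yields a maximal chain with [N] alternating labels,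
    but only [N - 1] absolute values are available. *)
Theorem octahedral_tucker N (label : (nat -> int) -> nat) : (0 < N)%N ->
  (forall X, sign_vector N X -> label (fun c => - X c) = flip (label X)) ->
  (forall X, sign_vector N X -> (label X < N.-1.*2)%N) ->
  exists X Y, [/\ sign_vector N X, sign_vector N Y, sign_le X Y
                & label Y = flip (label X)].
Proof.
move=> N0 label_opp label_lt; apply: contrapT => noXY.
have label_le X Y : sign_vector N X -> sign_vector N Y -> sign_le X Y ->
    label Y != flip (label X).
  by move=> sX sY XY; apply/eqP => e; apply: noXY; exists X, Y.
have := fan_parity_true label_opp label_le (leqnn N).
rewrite /fan_parity big1 // => s _; rewrite big1 // => p _; apply/negbTE/negP.
move/(fan_size (m := N.-1)); rewrite size_map size_iota.
suff : ~ (N <= N.-1)%N.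
  move=> h /(_ _ _)/h; apply; first exact: chain_labels_complement_free.
  move=> _ /mapP[j + ->]; rewrite mem_iota => /andP[j0 jN].
  by apply/label_lt/chain_sign_vector; lia.
lia.
Qed.

(** * Alternations of sign vectors *)

Implicit Types X Y : nat -> int.

Fixpoint last_sign (e : int) (X : nat -> int) m : int :=
  if m is m'.+1 then if X m' == 0 then last_sign e X m' else X m' else e.

Definition switch e X i := (X i != 0) && (X i != last_sign e X i).

(* The alternations of [X] preceded by an entry [e]. The minimum for [e = 1] and
   [e = - 1] is the alternation number of [X] minus 1, and their comparison
   gives the first nonzero sign of [X]. *)
Definition switches e X m : nat := (\sum_(0 <= i < m) switch e X i)%N.

Lemma switchesS e X m : switches e X m.+1 = (switches e X m + switch e X m)%N.
Proof. by rewrite /switches big_nat_recr. Qed.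

Lemma switches_opp e X m :
  switches (- e) (fun c => - X c) m = switches e X m.
Proof.
have ls k : last_sign (- e) (fun c => - X c) k = - last_sign e X k.
  by elim: k => //= k IHk; rewrite oppr_eq0 IHk; case: ifP.
apply: eq_bigr => i _; rewrite /switch ls oppr_eq0.
by rewrite (inj_eq oppr_inj).
Qed.

Lemma switches_le e X Y m : sign_le X Y ->
  (switches e X m <= switches e Y m)%N.
Proof.
(* The invariant is strengthened: when the last signs differ, [X] may gain one switch on [Y] later,
   so [Y] must already be ahead by one. *)
move=> XY; suff : (switches e X m + (last_sign e X m != last_sign e Y m)
    <= switches e Y m)%N by apply: leq_trans; rewrite leq_addr.
elim: m => [|m IHm]; first by rewrite /switches !big_geq //= eqxx.
move: IHm; rewrite !switchesS /switch /=.
case: (XY m) => [->|->]; rewrite ?eqxx /=.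
  case: (eqVneq (Y m) 0) => [_|_] /=; first by rewrite !addn0.
  by do 3 case: eqVneq => //=; try lia; congruence.
case: (eqVneq (Y m) 0) => [_|_] /=; first by rewrite !addn0.
rewrite eqxx; do 3 case: eqVneq => //=; try lia; congruence.
Qed.

(** The two counts agree up to the first nonzero entry, where exactly one of them gains a switch;
    from then on the last signs coincide. *)
Lemma switches_neq N X : sign_vector N X ->
  switches 1 X N = (switches (- 1) X N).+1 \/
  switches (- 1) X N = (switches 1 X N).+1.
Proof.
case=> Xs [c cN Xc0].
pose S m := switches 1 X m; pose S' m := switches (- 1) X m.
suff /(_ N) [[/(_ c cN) Xc _]|//] : forall m,
    [/\ forall c, (c < m)%N -> X c = 0, last_sign 1 X m = 1,
        last_sign (- 1) X m = -1 & S m = S' m] \/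
    [/\ last_sign 1 X m = last_sign (- 1) X m &
        S m = (S' m).+1 \/ S' m = (S m).+1].
- by rewrite Xc eqxx in Xc0.
- by case.
elim=> [|m [[X0 l1 l2 SS]|[ll SS]]].
- by left; split=> //; rewrite /S /S' /switches !big_geq.
- rewrite /S /S' !switchesS /switch -/(S m) -/(S' m) /= l1 l2.
  have := Xs m; rewrite !inE => /or3P[] /eqP Xm; rewrite Xm /=.
  + by right; split=> //; left; rewrite SS; lia.
  + left; split=> //; last by rewrite SS.
    by move=> d; rewrite ltnS leq_eqVlt => /orP[/eqP ->|/X0].
  + by right; split=> //; right; rewrite SS; lia.
right; rewrite /S /S' !switchesS /switch -/(S m) -/(S' m) /= ll.
by split=> //; case: (_ && _) => /=; lia.
Qed.

Lemma leq_sum_subrange (F : nat -> nat) a b c d : (a <= b)%N -> (b <= c)%N ->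
  (c <= d)%N -> (\sum_(b <= i < c) F i <= \sum_(a <= i < d) F i)%N.
Proof.
move=> ab bc cd; rewrite (big_cat_nat ab (leq_trans bc cd)) /=.
by rewrite (big_cat_nat bc cd) /= addnCA leq_addr.
Qed.

Lemma switches_zeros e X N :
  (\sum_(0 <= i < N) (X i == 0%R) + switches e X N <= N)%N.
Proof.
rewrite /switches -big_split /=.
apply: (@leq_trans (\sum_(0 <= i < N) 1)%N); last first.
  by rewrite sum_nat_const_nat subn0 muln1.
apply: leq_sum => i _; rewrite /switch.
by case: (X i == 0) => //=; case: (_ != _).
Qed.

(* There are [n + 1] blocks and at most [n] positions without a switch. *)
Lemma switches_block e X n L : (n.+1 * L - n <= switches e X (n.+1 * L))%N ->
  (0 < L)%N ->
  exists2 j, (j < n.+1)%N &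
    forall i, (j * L <= i < j.+1 * L)%N -> switch e X i.
Proof.
move=> le L0; apply: contrapT => no_block.
have /(_ n.+1 (leqnn _)) : forall k, (k <= n.+1)%N ->
    (switches e X (k * L) + k <= k * L)%N.
  elim=> [|k IHk] kn.
    by rewrite /switches mul0n big_geq.
  rewrite /switches (big_cat_nat (n := k * L)) //=; last first.
    by rewrite leq_mul2r leqnSn orbT.
  suff : (\sum_(k * L <= i < k.+1 * L) switch e X i < L)%N.
    by have := IHk (ltnW kn); rewrite /switches mulSn; lia.
  have [i /andP[ki iL] ni] :
      exists2 i, (k * L <= i < k.+1 * L)%N & ~~ switch e X i.
    apply: contrapT => noi; apply: no_block; exists k => // i ki.
    by apply/negPn/negP => ni; apply: noi; exists i.
  rewrite (big_cat_nat (n := i)) //=; last exact: ltnW.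
  rewrite [X in (_ + X < _)%N]big_ltn // (negbTE ni) add0n.
  have le1 a b : (\sum_(a <= t < b) switch e X t <= b - a)%N.
    rewrite -[X in (_ <= X)%N]muln1 -sum_nat_const_nat; apply: leq_sum => t _.
    by case: switch.
  by have := le1 (k * L)%N i; have := le1 i.+1 (k.+1 * L)%N; rewrite mulSn; lia.
nia.
Qed.

(** Every entry of the run is nonzero, hence is the last sign seen by the next one, which must be
    its opposite. *)
Lemma switch_run e X a i : (forall k, (a <= k <= i)%N -> switch e X k) ->
  (forall k, X k \in [:: -1; 0; 1]) -> (a <= i)%N ->
  (-1) ^+ i * X i = (-1) ^+ a * X a.
Proof.
move=> sw Xs; elim: i sw => [|i IHi] sw; first by rewrite leqn0 => /eqP ->.
rewrite leq_eqVlt => /orP[/eqP -> //|]; rewrite ltnS => ai.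
rewrite -IHi // => [|k /andP[ak ki]]; last by apply: sw; lia.
have /andP[Xi0 _] : switch e X i by apply: sw; lia.
have /andP[XSi0 /=] : switch e X i.+1 by apply: sw; lia.
rewrite (negbTE Xi0) exprS mulN1r mulNr -mulrN => XSi; congr (_ * _).
move: (Xs i) (Xs i.+1) XSi Xi0 XSi0; rewrite !inE.
by move=> /or3P[] /eqP -> /or3P[] /eqP ->; rewrite ?eqxx ?opprK ?oppr0.
Qed.

(** * Points of the cube attached to sign vectors *)

Section RowNorm.
Variables (R : realType) (n : nat).
Implicit Types w : 'rV[R]_n.

Lemma coord_le_norm w i : `|w ord0 i| <= `|w|.
Proof.
rewrite [leRHS]/Num.norm /= mx_normrE; apply/bigmax_geP; right.
by exists (ord0, i).
Qed.

Lemma norm_rV_le w c : 0 <= c -> (forall i, `|w ord0 i| <= c) -> `|w| <= c.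
Proof.
move=> c0 wc; rewrite [leLHS]/Num.norm /= mx_normrE.
by apply/bigmax_leP; split=> // -[i j] _ /=; rewrite (ord1 i).
Qed.

Definition coord_label w : nat :=
  if [pick i | `|w ord0 i| == `|w|] is Some i then (i.*2 + (0 < w ord0 i)%R)%N
  else 0%N.

Lemma coord_labelP w : w != 0 ->
  exists i : 'I_n, [/\ coord_label w = (i.*2 + (0 < w ord0 i)%R)%N,
    w ord0 i != 0 & `|w ord0 i| = `|w|].
Proof.
rewrite /coord_label => w0; case: pickP => [i /eqP wi|now].
  by exists i; split=> //; rewrite -normr_eq0 wi normr_eq0.
have : mx_norm w != 0 by rewrite (_ : mx_norm w = `|w|) // normr_eq0.
move/mx_norm_neq0 => [[i j] /=]; rewrite (ord1 i) => e.
by have := now j; rewrite -e eqxx.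
Qed.

Lemma coord_label_opp w : w != 0 -> coord_label (- w) = flip (coord_label w).
Proof.
move=> w0; rewrite /coord_label normrN.
under eq_pick => i do rewrite mxE normrN.
have [i] := coord_labelP w0; rewrite /coord_label.
case: pickP => [j /eqP wj _|now [_ _ /eqP]]; last by rewrite now.
have : w ord0 j != 0 by rewrite -normr_eq0 wj normr_eq0.
rewrite mxE oppr_gt0; case: ltgtP => //= _ _; rewrite /flip; lia.
Qed.

Lemma coord_label_lt w : w != 0 -> (coord_label w < n.*2)%N.
Proof.
move=> /coord_labelP[i [-> _ _]]; have := ltn_ord i.
by case: (_ < _) => /=; lia.
Qed.

(** At the common coordinate [v] attains its sup norm and [w] has the opposite sign, so the
    difference there is at least as large. *)
Lemma coord_label_flip v w : v != 0 -> w != 0 ->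
  coord_label w = flip (coord_label v) -> `|v| <= `|v - w|.
Proof.
move=> /coord_labelP[i [-> vi0 <-]] /coord_labelP[j [-> wj0 _]] ij.
have {ij} [ij sij] : j = i /\ (0 < w ord0 j) = ~~ (0 < v ord0 i).
  split; first apply/val_inj; move: ij; rewrite /flip /=;
  by case: (_ < _); case: (_ < _) => /=; lia.
rewrite {}ij in wj0 sij *.
apply: le_trans (coord_le_norm _ i); rewrite !mxE.
move: sij; case: (ltgtP (v ord0 i) 0) vi0 => // vi _ /=.
- move=> /idP wi; rewrite !ltr0_norm ?subr_lt0 //; lra.
- move=> /negbT; rewrite -leNgt => wi.
  rewrite !gtr0_norm // ?subr_gt0; lra.
Qed.

End RowNorm.

Section BlockMean.
Variables (R : realType) (n L : nat).
Hypothesis L_gt0 : (0 < L)%N.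
Let N := (n.+1 * L)%N.

(* The alternating signs turn the almost alternating vectors into vectors
   with few sign changes. *)
Definition block_mean X : 'rV[R]_n.+1 :=
  \row_j ((\sum_(j * L <= i < j.+1 * L) ((-1) ^+ i * X i)%:~R) / L%:R).

Lemma block_mean_opp X : block_mean (fun c => - X c) = - block_mean X.
Proof.
apply/rowP => j; rewrite !mxE -mulNr -sumrN; congr (_ / _).
by apply: eq_bigr => i _; rewrite mulrN mulrNz.
Qed.

Let L_neq0 : L%:R != 0 :> R. Proof. by rewrite pnatr_eq0 -lt0n. Qed.

Lemma sign_norm_le1 X i : (forall c, X c \in [:: -1; 0; 1]) ->
  `|((-1) ^+ i * X i)%:~R| <= 1 :> R.
Proof.
move=> Xs; rewrite rmorphM rmorphXn /= normrM normrX mulrN1z normrN1.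
rewrite expr1n mul1r.
have := Xs i; rewrite !inE => /or3P[] /eqP ->.
- by rewrite mulrN1z normrN1.
- by rewrite normr0.
- by rewrite normr1.
Qed.

(** On a block made of switches only, the signed entries are constant, so their mean is 1 or -1. *)
Lemma norm_block_mean X e : sign_vector N X ->
  (N - n <= switches e X N)%N -> `|block_mean X| = 1.
Proof.
move=> [Xs _] sw; apply/le_anti/andP; split.
  apply: norm_rV_le => // j; rewrite mxE normrM normfV normr_nat.
  rewrite ler_pdivrMr ?ltr0n // mul1r; apply: le_trans (ler_norm_sum _ _ _) _.
  apply: (@le_trans _ _ (\sum_(j * L <= i < j.+1 * L) 1)).
    by apply: ler_sum => i _; exact: sign_norm_le1.
  by rewrite sumr_const_nat mulSn addnK.
have [j jn swj] := switches_block sw L_gt0.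
apply: le_trans (coord_le_norm _ (Ordinal jn)); rewrite mxE /=.
under eq_big_nat => i /andP[ij iL].
  rewrite (@switch_run e X (j * L) i) //; last first.
    by move=> k /andP[jk ki]; apply: swj; rewrite jk (leq_ltn_trans ki).
  over.
rewrite sumr_const_nat mulSn addnK -[X in `|X / _|]mulr_natr mulfK //.
have /andP[Xj _] : switch e X (j * L).
  by apply: swj; rewrite leqnn /= mulSn -[ltnLHS]add0n ltn_add2r.
rewrite rmorphM rmorphXn /= normrM normrX mulrN1z normrN1 expr1n mul1r.
have := Xs (j * L)%N; rewrite !inE (negbTE Xj) /= => /orP[] /eqP ->.
- by rewrite mulrN1z normrN1.
- by rewrite normr1.
Qed.

(** [X] and [Y] differ only at zeros of [X]. These are not switches, so there are at most [n] of
    them, each contributing at most 1. *)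
Lemma dist_block_mean X Y e : sign_vector N X -> sign_vector N Y ->
  sign_le X Y -> (N - n <= switches e X N)%N ->
  `|block_mean X - block_mean Y| <= n%:R / L%:R.
Proof.
move=> [Xs _] [Ys _] XY sw; apply: norm_rV_le; first by rewrite divr_ge0.
move=> j; rewrite !mxE -mulrBl normrM normfV normr_nat.
rewrite ler_pM2r ?invr_gt0 ?ltr0n // -sumrB.
apply: le_trans (ler_norm_sum _ _ _) _.
apply: (@le_trans _ _ (\sum_(j * L <= i < j.+1 * L) (X i == 0)%:R)).
  apply: ler_sum => i _; case: (XY i) => [X0|->]; last by rewrite subrr normr0.
  by rewrite X0 eqxx mulr0 sub0r normrN sign_norm_le1.
rewrite -natr_sum ler_nat.
have := switches_zeros e X N.
have : (\sum_(j * L <= i < j.+1 * L) (X i == 0%R) <=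
        \sum_(0 <= i < N) (X i == 0%R))%N.
  apply: leq_sum_subrange => //; first by rewrite leq_mul2r leqnSn orbT.
  by rewrite leq_mul2r ltn_ord orbT.
rewrite -/N; lia.
Qed.

End BlockMean.

(** * The Borsuk-Ulam theorem *)

Section CubeLabel.
Variables (R : realType) (n L : nat) (q : 'rV[R]_n.+1 -> 'rV[R]_n).
Let N := (n.+1 * L)%N.

(** The test [a < b] says that the first nonzero sign is positive. The [N - n - 1] alternation
    labels and the [n] coordinate labels make up the [N - 1] that Tucker's lemma allows. *)
Definition cube_label X : nat :=
  let a := switches 1 X N in let b := switches (- 1) X N in
  if (minn a b < N - n.+1)%N then ((minn a b).*2 + (a < b))%N
  else ((N - n.+1).*2 + coord_label (q (block_mean R n L X)))%N.

Hypothesis L_gt0 : (0 < L)%N.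
Hypothesis q_opp : forall v, q (- v) = - q v.
Hypothesis q_neq0 : forall v, `|v| = 1 -> q v != 0.

(** The two counts differ by one, so the larger reaches [N - n] once the smaller reaches
    [N - n - 1]. *)
Lemma cube_label_large X : sign_vector N X ->
  ~~ (minn (switches 1 X N) (switches (- 1) X N) < N - n.+1)%N ->
  exists e, (N - n <= switches e X N)%N.
Proof.
move=> sX; have nN : (n.+1 <= N)%N by rewrite /N leq_pmulr.
case: (switches_neq sX) => e le; [exists 1|exists (- 1)]; lia.
Qed.

Lemma cube_label_mean_neq0 X : sign_vector N X ->
  ~~ (minn (switches 1 X N) (switches (- 1) X N) < N - n.+1)%N ->
  q (block_mean R n L X) != 0.
Proof.
move=> sX /(cube_label_large sX)[e eX]; apply: q_neq0.
exact: norm_block_mean sX eX.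
Qed.

Lemma cube_label_opp X : sign_vector N X ->
  cube_label (fun c => - X c) = flip (cube_label X).
Proof.
move=> sX; rewrite /cube_label.
have -> : switches 1 (fun c => - X c) N = switches (- 1) X N.
  by rewrite -{1}(opprK 1) switches_opp.
rewrite switches_opp minnC; case: ifPn => [_|large].
  rewrite flip_double -leqNgt; congr (_ + nat_of_bool _)%N.
  move: (switches_neq sX); move: (switches 1 X N) (switches (- 1) X N) => a b.
  lia.
rewrite block_mean_opp q_opp coord_label_opp ?cube_label_mean_neq0 //.
by rewrite /flip; lia.
Qed.

Lemma cube_label_lt X : sign_vector N X -> (cube_label X < N.-1.*2)%N.
Proof.
move=> sX; have nN : (n.+1 <= N)%N by rewrite /N leq_pmulr.
rewrite /cube_label; case: ifPn => [|large].
  move: (switches 1 X N) (switches (- 1) X N) => a b; lia.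
by have := coord_label_lt (cube_label_mean_neq0 sX large); lia.
Qed.

(** Two alternation labels cannot be complementary: the larger count of [X] would become the smaller
    one of [Y] and drop, against [switches_le]. Alternation and coordinate labels have disjoint
    ranges. *)
Lemma cube_label_flip X Y : sign_vector N X -> sign_vector N Y ->
  sign_le X Y -> cube_label Y = flip (cube_label X) ->
  exists v w, [/\ `|v| = 1, `|v - w| <= n%:R / L%:R
                & `|q v| <= `|q v - q w|].
Proof.
move=> sX sY XY; have := switches_le 1 N XY; have := switches_le (- 1) N XY.
rewrite /cube_label.
case: ifPn => [smallY|largeY]; case: ifPn => [smallX|largeX].
- rewrite flip_double -leqNgt; move: (switches_neq sX) (switches_neq sY) smallX.
  move: (switches 1 X N) (switches (- 1) X N) => a b.
  move: (switches 1 Y N) (switches (- 1) Y N) => a' b'; lia.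
- rewrite /flip; move: smallY.
  move: (switches 1 Y N) (switches (- 1) Y N) => a b; lia.
- rewrite flip_double; move: smallX.
  move: (switches 1 X N) (switches (- 1) X N) => a b; lia.
move=> _ _ e; exists (block_mean R n L X), (block_mean R n L Y).
have [e1 leX] := cube_label_large sX largeX; split.
- exact: norm_block_mean sX leX.
- exact: dist_block_mean sX sY XY leX.
- apply: coord_label_flip; rewrite ?cube_label_mean_neq0 //.
  by move: e; rewrite /flip; lia.
Qed.

Lemma cube_close_pair : exists v w, [/\ `|v| = 1, `|v - w| <= n%:R / L%:R
                & `|q v| <= `|q v - q w|].
Proof.
have N0 : (0 < N)%N by rewrite muln_gt0.
have [X [Y [sX sY XY e]]] := octahedral_tucker N0 cube_label_opp cube_label_lt.
exact: cube_label_flip sX sY XY e.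
Qed.

End CubeLabel.

Section BorsukUlam.
Variables (R : realType) (n : nat).

Lemma odd_zero_on_cube (q : 'rV[R]_n.+1 -> 'rV[R]_n) :
  (forall v, q (- v) = - q v) ->
  (forall v, `|v| = 1 -> {for v, continuous q}) ->
  exists2 v, `|v| = 1 & q v = 0.
Proof.
move=> q_opp q_cont; apply: contrapT => q0.
have {q0} q_neq0 v : `|v| = 1 -> q v != 0.
  by move=> v1; apply/eqP => qv; apply: q0; exists v.
pose K := [set v : 'rV[R]_n.+1 | `|v| = 1].
have /compact_near_coveringP Kcov : compact K.
  apply: bounded_closed_compact.
    by exists 1; split=> // M M1 v /= ->; exact: ltW.
  have -> : K = (fun v => `|v|) @^-1` [set 1] by [].
  apply: closed_comp => [v _|]; first exact: norm_continuous.
  exact: closed_eq.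
(* [P d v] excludes the jump given by [cube_close_pair]; compactness of the boundary of the cube
   makes [d] uniform. *)
pose P (d : R) v := forall w, `|v - w| < d -> `|q v - q w| < `|q v|.
have /Kcov : forall v, K v -> \forall v' \near v & d \near 0^'+, P d v'.
  move=> v v1; have c0 : 0 < `|q v| by rewrite normr_gt0 q_neq0.
  (* With thirds, [q v'] and [q w] are less than two thirds of [|q v|] apart, while [|q v'|] exceeds
     two thirds of it. *)
  have /cvgrPdist_lt/(_ (`|q v| / 3)) := q_cont v v1.
  rewrite divr_gt0 // => /(_ isT)/nbhs_ballP[r /= r0 qr].
  exists (ball v (r / 2), [set d | d < r / 2]).
    split; first by apply: nbhsx_ballx; rewrite divr_gt0.
    by apply: nbhs_right_lt; rewrite divr_gt0.
  move=> [v' d] [/=]; rewrite mx_norm_ball /ball_ /= => vv' dr w v'w.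
  have qv' : `|q v - q v'| < `|q v| / 3.
    by apply: qr; rewrite mx_norm_ball /ball_ /=; lra.
  have qw : `|q v - q w| < `|q v| / 3.
    apply: qr; rewrite mx_norm_ball /ball_ /=.
    have := ler_distD v' v w; lra.
  have := ler_distD (q v) (q v') (q w); rewrite (distrC (q v') (q v)).
  have := ler_normD (q v - q v') (q v'); rewrite subrK; lra.
move=> near_d.
have [d [d0 Pd]] : exists d : R, 0 < d /\ K `<=` P d.
  have [d] := filter_ex (filterI (nbhs_right_gt (0 : R)) near_d).
  by case=> d0 Pd; exists d.
have nd0 : 0 <= n%:R / d by rewrite divr_ge0 // ltW.
have nL := archi_boundP nd0; set L := Num.bound _ in nL.
have L0 : (0 < L)%N by rewrite -(ltr0n R) (le_lt_trans nd0).
have [v [w [v1 vw]]] := cube_close_pair L0 q_opp q_neq0.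
rewrite leNgt => /negP; apply; apply: Pd => //; apply: le_lt_trans vw _.
by rewrite ltr_pdivrMr ?ltr0n // mulrC -ltr_pdivrMr.
Qed.

Definition euclid_norm (v : 'rV[R]_n.+1) : R :=
  Num.sqrt (\sum_i v ord0 i ^+ 2).

Lemma euclid_norm_gt0 v : v != 0 -> 0 < euclid_norm v.
Proof.
move=> v0; rewrite sqrtr_gt0 lt_neqAle sumr_ge0 ?andbT => [|i _]; last first.
  exact: sqr_ge0.
apply: contra v0 => /eqP/esym/eqP.
rewrite psumr_eq0 => [/allP v0|i _]; last first.
  exact: sqr_ge0.
apply/eqP/rowP => i; rewrite mxE; apply/eqP.
by have := v0 i (mem_index_enum i); rewrite sqrf_eq0.
Qed.

Lemma sphere_normalize v : v != 0 -> sphere R n ((euclid_norm v)^-1 *: v).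
Proof.
move=> /euclid_norm_gt0; rewrite sqrtr_gt0 => s0; rewrite /sphere /=.
under eq_bigr => i _ do rewrite mxE exprMn.
by rewrite -mulr_sumr exprVn sqr_sqrtr ?ltW // mulVf ?gt_eqF.
Qed.

Lemma euclid_norm_continuous : continuous euclid_norm.
Proof.
move=> v; rewrite /euclid_norm.
apply: (@continuous_comp _ _ _ (fun v : 'rV[R]_n.+1 => \sum_i v ord0 i ^+ 2)
  (@Num.sqrt R)); last exact: sqrt_continuous.
have cont : continuous (fun v : 'rV[R]_n.+1 => \sum_i v ord0 i ^+ 2).
  apply: continuous_big => [|i _ w]; first exact: add_continuous.
  apply: (@continuous_comp _ _ _ (fun v : 'rV[R]_n.+1 => v ord0 i)
    (fun t => t ^+ 2)); first exact: coord_continuous.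
  exact: exprn_continuous.
exact: cont.
Qed.

(** Radial projection from the boundary of the cube to the sphere is odd, and continuous away from
    0. *)
Theorem borsuk_ulam (h : 'rV[R]_n.+1 -> 'rV[R]_n) :
  continuous h -> (forall x, h (- x) = - h x) ->
  exists2 x, sphere R n x & h x = 0.
Proof.
move=> h_cont h_opp; pose q v := h ((euclid_norm v)^-1 *: v).
have [||v v1 qv] := @odd_zero_on_cube q.
- move=> v; rewrite /q -h_opp -scalerN; congr (h (_^-1 *: _)).
  by congr Num.sqrt; apply: eq_bigr => i _; rewrite mxE sqrrN.
- move=> v v1; apply: continuous_comp; last exact: h_cont.
  have v0 : v != 0 by rewrite -normr_eq0 v1 oner_eq0.
  apply: continuousZ; last by [].
  apply: continuousV; first by rewrite gt_eqF // euclid_norm_gt0.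
  exact: euclid_norm_continuous.
exists ((euclid_norm v)^-1 *: v) => //; apply: sphere_normalize.
by rewrite -normr_eq0 v1 oner_eq0.
Qed.

End BorsukUlam.

(** * Antipodal-free covers *)

Section SetDist.
Variables (R : realType) (V : normedModType R).
Implicit Types (C : set V) (x y : V).

Definition set_dist C x : R := inf [set `|x - y| | y in C].

Let has_lb C x : has_lbound [set `|x - y| | y in C].
Proof. by exists 0 => _ [y _ <-]. Qed.

Lemma set_dist_le C x y : C y -> set_dist C x <= `|x - y|.
Proof. by move=> Cy; apply: ge_inf => //; exists y. Qed.

Lemma le_set_dist C x r : C !=set0 -> (forall y, C y -> r <= `|x - y|) ->
  r <= set_dist C x.
Proof.
move=> [y Cy] rC; apply: lb_le_inf; first by exists `|x - y|, y.
by move=> _ [z Cz <-]; exact: rC.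
Qed.

Lemma set_dist_ge0 C x : 0 <= set_dist C x.
Proof.
have [->|/set0P C0] := eqVneq C set0; last exact: le_set_dist.
by rewrite /set_dist image_set0 inf0.
Qed.

Lemma set_dist0 C x : C x -> set_dist C x = 0.
Proof.
move=> Cx; apply/le_anti; rewrite set_dist_ge0 andbT.
by rewrite (le_trans (set_dist_le _ Cx)) // subrr normr0.
Qed.

Lemma set_dist_lipschitz C x y : set_dist C x <= `|x - y| + set_dist C y.
Proof.
have [->|/set0P C0] := eqVneq C set0.
  by rewrite /set_dist !image_set0 inf0 addr0.
rewrite -lerBlDl; apply: le_set_dist => // z Cz; rewrite lerBlDl.
exact: le_trans (set_dist_le _ Cz) (ler_distD _ _ _).
Qed.

Lemma set_dist_continuous C : continuous (set_dist C).
Proof.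
move=> x; apply/cvgrPdist_lt => e e0.
apply/nbhs_normP; exists e => //= y; rewrite /ball_ /= => xy.
apply: le_lt_trans xy; rewrite ler_norml.
have := set_dist_lipschitz C x y; have := set_dist_lipschitz C y x.
rewrite (distrC y x); lra.
Qed.

End SetDist.

Lemma row_continuous (R : realType) (T : topologicalType) n
    (f : 'I_n -> T -> R) :
  (forall i, continuous (f i)) -> continuous (fun x => \row_i f i x).
Proof.
move=> fc x; apply/cvgrPdist_le => e e0.
have : \forall y \near x, forall i, `|f i x - f i y| <= e.
  by apply: filter_forall => i; have /cvgrPdist_le := fc i x; apply.
apply: filterS => y fy; apply: norm_rV_le => [|i]; first exact: ltW.
by rewrite !mxE.
Qed.

Lemma sphere_opp (R : realType) n (x : 'rV[R]_n.+1) :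
  sphere R n x -> sphere R n (- x).
Proof.
by rewrite /sphere /= => <-; apply: eq_bigr => i _; rewrite mxE sqrrN.
Qed.

Section SphereCover.
Variables (R : realType) (n m : nat) (A : 'I_m -> set 'rV[R]_n.+1).
Hypothesis A_cover : antipodal_free_open_cover A.

Definition nth_set (i : nat) : set 'rV[R]_n.+1 := oapp A set0 (insub i).

Lemma nth_set_ord (i : 'I_m) : nth_set i = A i.
Proof. by rewrite /nth_set valK. Qed.

Definition depth i x := set_dist (sphere R n `\` nth_set i) x.

Lemma nth_set_antipodal i x : nth_set i x -> ~ nth_set i (- x).
Proof.
have [_ Afree _] := A_cover; rewrite /nth_set.
by case: insub => //= j Ax ANx; apply: (Afree j); exists x.
Qed.

(** Relative openness bounds the distance below. The complement contains [- x], so the infimum is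
    not the default value 0 of the empty set. *)
Lemma depth_gt0 i x : sphere R n x -> (0 < depth i x) <-> nth_set i x.
Proof.
move=> Sx; split=> [|Ax].
  by apply: contraPP => nAx; rewrite /depth set_dist0 ?ltxx.
have [r r0 rA] : exists2 r, 0 < r &
    forall y, sphere R n y -> `|x - y| < r -> nth_set i y.
  have [Aopen _ _] := A_cover; move: Ax; rewrite /nth_set.
  case: insub => //= j Ax; have [_ /open_subspaceP[V oV VA]] := Aopen j.
  have Vx : V x.
    suff : (V `&` sphere R n) x by case.
    by rewrite VA.
  have /nbhs_normP[r r0 rV] : nbhs x V by apply: open_nbhs_nbhs.
  exists r => // y Sy xy; suff : (A j `&` sphere R n) y by case.
  by rewrite -VA; split=> //; exact: rV.
apply: lt_le_trans r0 _; apply: le_set_dist => [|y [Sy nAy]].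
  by exists (- x); split; [exact: sphere_opp|exact: nth_set_antipodal].
by rewrite leNgt; apply/negP => /(rA y Sy).
Qed.

Definition odd_depth i x := depth i x - depth i (- x).

Lemma odd_depth_opp i x : odd_depth i (- x) = - odd_depth i x.
Proof. by rewrite /odd_depth (opprK x) opprB. Qed.

Lemma odd_depth_continuous i : continuous (odd_depth i).
Proof.
move=> x; apply: continuousB; first exact: set_dist_continuous.
apply: (@continuous_comp _ _ _ (@GRing.opp 'rV[R]_n.+1) (depth i)).
  exact: opp_continuous.
exact: set_dist_continuous.
Qed.

Lemma odd_depth_eq0 i x : sphere R n x -> odd_depth i x = 0 -> ~ nth_set i x.
Proof.
move=> Sx /subr0_eq d Ax; apply: (nth_set_antipodal Ax).
by apply/(depth_gt0 _ (sphere_opp Sx)); rewrite -d; apply/depth_gt0.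
Qed.

Lemma odd_depth_pos i x : sphere R n x -> 0 < odd_depth i x -> nth_set i x.
Proof.
move=> Sx; rewrite subr_gt0 => d; apply/depth_gt0 => //.
exact: le_lt_trans (set_dist_ge0 _ _) d.
Qed.

Lemma odd_depth_diagonal :
  exists2 x, sphere R n x &
    forall i, (i <= n)%N -> odd_depth i x = odd_depth 0 x.
Proof.
pose h x := \row_(j < n) (odd_depth j.+1 x - odd_depth 0 x).
have [||x Sx hx] := @borsuk_ulam R n h.
- apply: row_continuous => i x.
  by apply: continuousB; exact: odd_depth_continuous.
- by move=> x; apply/rowP => j; rewrite !mxE !odd_depth_opp; lra.
exists x => // -[//|i] ni; apply: subr0_eq.
by have /rowP/(_ (Ordinal ni)) := hx; rewrite !mxE.
Qed.

Lemma cover_common_point : (m <= n.+2)%N ->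
  exists2 x, sphere R n x & forall i, (i <= n)%N -> nth_set i x.
Proof.
move=> mn; have [x Sx dx] := odd_depth_diagonal.
have [d0|d0|d0] := ltgtP (odd_depth 0 x) 0.
- exists (- x); first exact: sphere_opp.
  move=> i ni; apply: odd_depth_pos; first exact: sphere_opp.
  by rewrite odd_depth_opp dx // oppr_gt0.
- by exists x => // i ni; apply: odd_depth_pos; rewrite // dx.
(* Stated for [y] so as to apply to both [x] and [- x]; as [m <= n + 2], only the index [n + 1] is
   left. *)
have last_set y : sphere R n y -> odd_depth 0 y = 0 ->
    (forall i, (i <= n)%N -> odd_depth i y = odd_depth 0 y) -> nth_set n.+1 y.
  move=> Sy d0y dy; have [_ _ /(_ y Sy)[j _ Ajy]] := A_cover.
  have [nj|nj] := leqP j n.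
    by case: (@odd_depth_eq0 j y); rewrite ?dy // nth_set_ord.
  by rewrite (_ : n.+1 = j) ?nth_set_ord //; have := ltn_ord j; lia.
case: (@nth_set_antipodal n.+1 x); first exact: last_set.
apply: last_set; first exact: sphere_opp.
  by rewrite odd_depth_opp d0 oppr0.
by move=> i ni; rewrite !odd_depth_opp dx.
Qed.

Theorem exists_multiplicity_gt : (m <= n.+2)%N ->
  exists2 x, sphere R n x & (n < multiplicity A x)%N.
Proof.
move=> /cover_common_point[x Sx Ax]; exists x => //.
(* The padding sets are empty, so the set of index [n] containing [x] belongs to the family. *)
have nm : (n < m)%N.
  by have := Ax n (leqnn n); rewrite /nth_set; case: insubP.
rewrite /multiplicity -[X in (X <= _)%N]card_ord.
have inj : injective (widen_ord nm) by move=> i j [] /val_inj.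
rewrite -(card_codom inj); apply: subset_leq_card.
apply/fintype.subsetP => _ /codomP[i ->]; rewrite inE -nth_set_ord.
exact/Ax/(ltn_ord i).
Qed.

End SphereCover.

Theorem theorem4p3 (R : realType) (k : nat) (hk : (2 <= k)%N) :
  (~ exists (m : nat) (A : 'I_m -> set 'rV[R]_(2 * k - 1).+1),
       [/\ (m <= 2 * k + 1)%N,
           antipodal_free_open_cover A
         & forall x, sphere R (2 * k - 1) x -> (multiplicity A x <= k + 1)%N])
  /\
  (~ exists (m : nat) (A : 'I_m -> set 'rV[R]_(2 * k).+1),
       [/\ (m <= 2 * k + 2)%N,
           antipodal_free_open_cover A
         & forall x, sphere R (2 * k) x -> (multiplicity A x <= k + 2)%N]).
Proof.
(* Multiplicities of at least [2 k] and [2 k + 1] exceed [k + 1] and [k + 2] because [k >= 2]. *)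
split=> -[m [A [mk A_cover A_le]]].
  have [|x Sx] := exists_multiplicity_gt A_cover; first by lia.
  by have := A_le x Sx; lia.
have [|x Sx] := exists_multiplicity_gt A_cover; first by lia.
by have := A_le x Sx; lia.
Qed.
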